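(* For $n\ge 1$, the reduced regular path homology of the complete graph $K_n$ on $n$ vertices is concentrated in degree $n-1$, where it has rank equal to the number of derangements $D(n)=\sum_{j=0}^{n}(-1)^j\frac{n!}{j!}$.
   Context: $R$ is a fixed nonzero commutative unital ring; rank means rank as a free $R$-module. The complete graph $K_n$ is regarded as the directed graph having both directed edges $(x,y)$ and $(y,x)$ for every pair of distinct vertices $x,y$. A directed graph $G$ has vertex set $V(G)$ and edge set $E(G)\subseteq V(G)\times V(G)$. Regular path homology: let $\Lambda_m(G)$ be the free $R$-module on all $(m+1)$-tuples of vertices, with $\partial=\sum_{i=0}^m(-1)^i(\text{delete the } i\text{-th entry})$ (and $\partial=0$ for $m=0$). A tuple $(x_0,\dots,x_m)$ is allowed if $(x_i,x_{i+1})\in E(G)$ for all $i$, and strongly regular if its entries are pairwise distinct. Let $\mathcal{A}^\iota_m(G)\subseteq\Lambda_m(G)$ be spanned by the strongly regular allowed tuples, and $\Omega^\iota_m(G)=\{v\in\mathcal{A}^\iota_m(G)\mid \partial v\in\mathcal{A}^\iota_{m-1}(G)\}$ (with $\Omega^\iota_0=\mathcal{A}^\iota_0$). The regular path homology groups are the homology groups of $(\Omega^\iota_*(G),\partial)$; the reduced groups are the homology groups of the complex augmented by $\Omega^\iota_0(G)\to R$, $x\mapsto 1$ for every vertex $x$. *)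

(* Defs.v *)
From HB Require Import structures.
From mathcomp Require Import all_boot all_order all_algebra perm.
From mathcomp Require Import boolp.
From mathcomp Require Import zify.

Set Implicit Arguments.
Unset Strict Implicit.
Unset Printing Implicit Defensive.

Import GRing.Theory.
Local Open Scope ring_scope.

Section Submodule.
Variables (R : pzRingType) (V : lmodType R) (S : submodClosed V).

Record submodule := Submodule { submodule_val :> V; _ : submodule_val \in S }.

HB.instance Definition _ := [isSub for submodule_val].
HB.instance Definition _ := [Choice of submodule by <:].
HB.instance Definition _ := [SubChoice_isSubLmodule of submodule by <:].
End Submodule.

Section QuotientModule.
Variables (R : pzRingType) (V : lmodType R) (S : submodClosed V).
Local Open Scope quotient_scope.

(* submodClosed does not carry closure under opposites, which the additive
   quotient asks for. *)
Definition zmod_of_submod : {pred V} := fun v => v \in S.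

Fact zmod_of_submod_closed : zmod_closed zmod_of_submod.
Proof. exact: GRing.subsemimod_closedB (GRing.subsemimodClosedP S). Qed.
HB.instance Definition _ :=
  GRing.isZmodClosed.Build V zmod_of_submod zmod_of_submod_closed.

(* The additive quotient group V / S of ring_quotient, with its R-action. *)
Definition additive_submod : zmodClosed V :=
  GRing.ZmodClosed.clone V zmod_of_submod _.

Definition quotient_module : Type := Quotient.quot additive_submod.

HB.instance Definition _ := GRing.Zmodule.on quotient_module.

Definition quot_scale (a : R) (x : quotient_module) : quotient_module :=
  \pi_(Quotient.quot additive_submod) (a *: repr x).

Lemma pi_scale (a : R) (v : V) :
  quot_scale a (\pi_(Quotient.quot additive_submod) v) = \pi_(Quotient.quot zmod_of_submod) (a *: v).
Proof.
apply/eqP; rewrite -Quotient.idealrBE -scalerBr.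
suff: repr (\pi_(Quotient.quot additive_submod) v) - v \in additive_submod.
  exact: rpredZ.
by rewrite Quotient.idealrBE reprK.
Qed.

Fact quot_scaleA a b x :
  quot_scale a (quot_scale b x) = quot_scale (a * b) x.
Proof. by rewrite pi_scale scalerA. Qed.

Fact quot_scale1 : left_id 1 quot_scale.
Proof. by move=> x; rewrite /quot_scale scale1r reprK. Qed.

Fact quot_scaleDr : right_distributive quot_scale +%R.
Proof.
move=> a x y; rewrite -[x in LHS]reprK -[y in LHS]reprK -raddfD pi_scale.
by rewrite scalerDr raddfD.
Qed.

Fact quot_scaleDl x : {morph quot_scale^~ x : a b / a + b}.
Proof. by move=> a b; rewrite /quot_scale scalerDl raddfD. Qed.

HB.instance Definition _ := GRing.Zmodule_isLmodule.Build R quotient_module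
  quot_scaleA quot_scale1 quot_scaleDr quot_scaleDl.
End QuotientModule.

Section Homology.
Variables (R : pzRingType) (U V W : lmodType R).
Variables (f : {linear U -> V}) (g : {linear V -> W}).

Definition cycle_pred : {pred V} := fun v => g v == 0.

Fact cycle_pred_closed : submod_closed cycle_pred.
Proof.
split=> [|a u v]; rewrite !unfold_in /cycle_pred ?linear0 //.
by rewrite linearP => /eqP-> /eqP->; rewrite scaler0 addr0.
Qed.
HB.instance Definition _ :=
  GRing.isSubmodClosed.Build R V cycle_pred
    (GRing.submod_closed_semi cycle_pred_closed).

Definition cycles := submodule cycle_pred.

HB.instance Definition _ := GRing.Lmodule.on cycles.

Definition boundary_pred : {pred cycles} := fun z => `[< exists u, f u = val z >].

Fact boundary_pred_closed : submod_closed boundary_pred.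
Proof.
split=> [|a u v]; first by apply/asboolP; exists 0; rewrite !linear0.
move=> /asboolP[x fx] /asboolP[y fy]; apply/asboolP.
by exists (a *: x + y); rewrite !linearP fx fy.
Qed.
HB.instance Definition _ :=
  GRing.isSubmodClosed.Build R cycles boundary_pred
    (GRing.submod_closed_semi boundary_pred_closed).

(* ker g / im f, for composable maps with g \o f = 0. *)
Definition homology : lmodType R := quotient_module boundary_pred.
End Homology.

Definition free_of_rank (R : nzRingType) (M : lmodType R) (r : nat) : Prop :=
  exists h : {linear 'rV[R]_r -> M}, bijective h.

Definition is_zero_module (R : pzRingType) (M : lmodType R) : Prop :=
  forall x : M, x = 0.

Section PathComplex.
Variables (R : comNzRingType) (V : finType) (e : rel V).

(* The free module on (m+1)-tuples of vertices, a chain being its family of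
   coefficients. *)
Definition Lambda (m : nat) : lmodType R := {ffun m.+1.-tuple V -> R^o}.

Definition basis m (x : m.+1.-tuple V) : Lambda m :=
  [ffun y => (y == x)%:R].

Definition delete m (i : 'I_m.+2) (x : m.+2.-tuple V) : m.+1.-tuple V :=
  [tuple tnth x (lift i j) | j < m.+1].

(* The boundary Lambda_(m+1) -> Lambda_m; the zero boundary on Lambda_0 is
   left implicit. *)
Definition bd m (v : Lambda m.+1) : Lambda m :=
  \sum_x \sum_(i < m.+2) v x *: ((-1) ^+ i *: basis (delete i x)).

Fact bd_is_linear m : linear (@bd m).
Proof.
move=> a u v; rewrite /bd scaler_sumr -big_split; apply: eq_bigr => x _.
rewrite scaler_sumr -big_split; apply: eq_bigr => i _.
have -> : (a *: u + v) x = a * u x + v x by rewrite !ffunE.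
by rewrite scalerDl -scalerA.
Qed.
HB.instance Definition _ m :=
  GRing.isLinear.Build R (Lambda m.+1) (Lambda m) _ (@bd m) (@bd_is_linear m).

Lemma bd_basis m (x : m.+2.-tuple V) :
  bd (basis x) = \sum_(i < m.+2) (-1) ^+ i *: basis (delete i x).
Proof.
rewrite /bd (bigD1 x) //= [X in _ + X]big1 ?addr0 => [|y /negPf yx].
  by apply: eq_bigr => i _; rewrite ffunE eqxx scale1r.
by apply: big1 => i _; rewrite ffunE yx scale0r.
Qed.

Lemma delete_delete m (x : m.+3.-tuple V) (i : 'I_m.+3) (j : 'I_m.+2)
    (i' : 'I_m.+3) (j' : 'I_m.+2) :
  (j < i)%N -> i' = j :> nat -> j' = i.-1 :> nat ->
  delete j (delete i x) = delete j' (delete i' x).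
Proof.
move=> ji ei ej; apply: eq_from_tnth => k; rewrite !tnth_mktuple.
congr (tnth x _); apply: val_inj => /=; rewrite ei ej /bump.
by lia.
Qed.

Lemma bd_bd m (v : Lambda m.+2) : bd (bd v) = 0.
Proof.
rewrite {2}/bd raddf_sum big1 // => x _; rewrite raddf_sum /=.
under eq_bigr => i _.
  rewrite linearZ /= linearZ /= bd_basis scaler_sumr.
  under eq_bigr do rewrite scalerA -exprD.
  over.
rewrite -scaler_sumr pair_big /= (bigID (fun p : 'I_m.+3 * 'I_m.+2 => (p.2 < p.1)%N)) /=.
pose h (p : 'I_m.+3 * 'I_m.+2) : 'I_m.+3 * 'I_m.+2 :=
  (inord p.2, inord p.1.-1).
pose h' (p : 'I_m.+3 * 'I_m.+2) : 'I_m.+3 * 'I_m.+2 :=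
  (inord p.2.+1, inord p.1).
have hE (p : 'I_m.+3 * 'I_m.+2) : (p.2 < p.1)%N ->
    (h p).1 = p.2 :> nat /\ (h p).2 = p.1.-1 :> nat.
  by case: p => i j /= ji; have li := ltn_ord i; have lj := ltn_ord j;
     rewrite !inordK; lia.
have h'E (p : 'I_m.+3 * 'I_m.+2) : ~~ (p.2 < p.1)%N ->
    (h' p).1 = p.2.+1 :> nat /\ (h' p).2 = p.1 :> nat.
  by case: p => i j /= ji; have li := ltn_ord i; have lj := ltn_ord j;
     rewrite !inordK; lia.
have pairE (p q : 'I_m.+3 * 'I_m.+2) :
    p.1 = q.1 :> nat -> p.2 = q.2 :> nat -> p = q.
  by case: p q => [i j] [i' j'] /= /val_inj-> /val_inj->.
rewrite [X in _ + X](reindex_onto h h') /= => [|p pP]; last first.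
  have [e1 e2] := h'E p pP.
  have [e3 e4] : (h (h' p)).1 = (h' p).2 :> nat
      /\ (h (h' p)).2 = (h' p).1.-1 :> nat by apply: hE; lia.
  by apply: pairE; lia.
rewrite [X in _ + X](eq_bigl (fun p : 'I_m.+3 * 'I_m.+2 => (p.2 < p.1)%N)) => [|p]; last first.
  apply/andP/idP => [[hp /eqP hK]|pP].
    have {}hp : ~~ ((h p).2 < (h p).1)%N := hp.
    have [] := h'E (h p) hp; rewrite [h' (h p)]hK => e1 e2.
    by rewrite e1 e2; lia.
  have [e1 e2] := hE p pP.
  have hp : ~~ ((h p).2 < (h p).1)%N by lia.
  split=> //; apply/eqP; have [e3 e4] := h'E (h p) hp.
  by apply: pairE; lia.
rewrite -big_split big1 ?scaler0 //= => -[i j] /= ji.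
have [/= e1 e2] := hE (i, j) ji.
rewrite -(@delete_delete _ x i j _ _ ji e1 e2) -scalerDl /= e1 e2.
rewrite -[in X in X + _](@prednK i) ?addSn ?(leq_ltn_trans _ ji) //.
by rewrite addnC exprS mulN1r addnC addNr scale0r.
Qed.

Definition strongly_regular_allowed m (x : m.+1.-tuple V) : bool :=
  sorted e x && uniq x.

(* A chain lies in the span of a set of tuples iff its coefficients vanish
   outside that set. *)
Definition A_pred m : {pred Lambda m} :=
  fun v => [forall x, ~~ strongly_regular_allowed x ==> (v x == 0)].

Fact A_pred_closed m : submod_closed (@A_pred m).
Proof.
split=> [|a u v]; first by apply/forallP => x; rewrite ffunE eqxx implybT.
move=> /forallP uA /forallP vA; apply/forallP => x; apply/implyP => nx.
move: (uA x) (vA x); rewrite nx !ffunE /= => /eqP-> /eqP->.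
by rewrite scaler0 addr0.
Qed.
HB.instance Definition _ m := GRing.isSubmodClosed.Build R (Lambda m) (@A_pred m)
  (GRing.submod_closed_semi (@A_pred_closed m)).

Definition Omega_pred m : {pred Lambda m} :=
  match m with
  | 0%N => @A_pred 0
  | k.+1 => fun v => (v \in @A_pred k.+1) && (bd v \in @A_pred k)
  end.

Fact Omega_pred_closed m : submod_closed (@Omega_pred m).
Proof.
case: m => [|m]; first exact: A_pred_closed.
have OE w : (w \in @Omega_pred m.+1) =
    (w \in @A_pred m.+1) && (bd w \in @A_pred m) by [].
split=> [|a u v]; first by rewrite OE linear0 !rpred0.
rewrite !OE linearP => /andP[uA duA] /andP[vA dvA].
by apply/andP; split; apply: rpredD => //; apply: rpredZ.
Qed.
HB.instance Definition _ m :=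
  GRing.isSubmodClosed.Build R (Lambda m) (@Omega_pred m)
    (GRing.submod_closed_semi (@Omega_pred_closed m)).

Definition Omega m : lmodType R := submodule (@Omega_pred m).

Fact bd_Omega m (w : Omega m.+1) : bd (val w) \in @Omega_pred m.
Proof.
case: w => w /=; rewrite unfold_in => /andP[_ dw].
case: m w dw => [|m] w dw //=; rewrite unfold_in dw /=.
by rewrite bd_bd; exact: rpred0.
Qed.

Definition path_bd m (w : Omega m.+1) : Omega m := Submodule (bd_Omega w).

Fact path_bd_is_linear m : linear (@path_bd m).
Proof. by move=> a u v; apply: val_inj; rewrite /= !linearP. Qed.
HB.instance Definition _ m :=
  GRing.isLinear.Build R (Omega m.+1) (Omega m) _ (@path_bd m) (@path_bd_is_linear m).

Definition augmentation (w : Omega 0) : R^o := \sum_x val w x.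

Fact augmentation_is_linear : linear augmentation.
Proof.
move=> a u v; rewrite /augmentation scaler_sumr -big_split.
by apply: eq_bigr => x _; rewrite /= !ffunE.
Qed.
HB.instance Definition _ :=
  GRing.isLinear.Build R (Omega 0) R^o _ augmentation augmentation_is_linear.

Lemma path_bd_bd m (w : Omega m.+2) : path_bd (path_bd w) = 0.
Proof. by apply: val_inj; exact: bd_bd. Qed.

Lemma augmentation_path_bd (w : Omega 1) : augmentation (path_bd w) = 0.
Proof.
rewrite /augmentation /= /bd.
under eq_bigr do rewrite sum_ffunE.
rewrite exchange_big big1 //= => x _.
under eq_bigr do rewrite sum_ffunE.
rewrite exchange_big /=.
have sum1 (i : 'I_2) : \sum_y (val w x *: ((-1) ^+ i *: basis (delete i x))) y
    = val w x * (-1) ^+ i.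
  rewrite (bigD1 (delete i x)) //= !ffunE eqxx [X in _ + X]big1 ?addr0.
    by congr (_ * _); exact: mulr1.
  by move=> y /negPf yx; rewrite !ffunE yx !scaler0.
under eq_bigr do rewrite sum1.
by rewrite !big_ord_recl big_ord0 /= expr0 expr1 mulr1 mulrN1 addr0 subrr.
Qed.

(* Homology of  ... -> Omega 1 -> Omega 0 -> R -> 0, with R in degree -1. *)
Definition reduced_path_homology (m : int) : lmodType R :=
  match m with
  | Posz k.+1 => homology (@path_bd k.+1) (@path_bd k)
  | Posz 0 => homology (@path_bd 0) augmentation
  | Negz 0 => homology augmentation (\0 : {linear R^o -> 'rV[R]_0})
  | Negz _.+1 => 'rV[R]_0
  end.
End PathComplex.

Definition complete_digraph (n : nat) : rel 'I_n := fun x y => x != y.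

Definition derangements (n : nat) : {set 'S_n} :=
  [set s : 'S_n | [forall i, s i != i]].

(* Main.v *)
Require Import Defs.
From HB Require Import structures.
From mathcomp Require Import all_boot all_order all_algebra perm.
From mathcomp Require Import boolp.
From mathcomp Require Import zify.
Import GRing.Theory Num.Theory.

Set Implicit Arguments.
Unset Strict Implicit.
Unset Printing Implicit Defensive.
Local Open Scope ring_scope.

(* For the complete graph the complex is the complex of injective words on n
   letters.  It carries an acyclic matching: call a letter b of a word w bad if
   every smaller letter occurs before b, and b is the first letter or its
   predecessor is smaller than b.  Deleting the least bad letter is a bijection
   from the words of length k+1 with a bad letter ("down") onto the words of
   length k < n without one ("up"), and, ordering words by the lexicographic
   order of the position vectors of their letters, the down-up block of the
   boundary is triangular with entries +-1 on the diagonal, over any ring.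
   Hence the complex is exact below length n, and the cycles of length n are
   freely parametrised by their coefficients on the permutations without bad
   letter.  Counting words through the matching gives
   n! - n!/1! + n!/2! - ... for the number of these, which is the number of
   derangements by inclusion-exclusion. *)

(** * Injective words and their bad letters *)

Section Words.
Variable n : nat.
Implicit Types (w : seq 'I_n) (a b c x : 'I_n).
Local Open Scope nat_scope.

Lemma index_rem (T : eqType) (w : seq T) (x c : T) : x \in w -> c != x ->
  index c (rem x w) = index c w - (index x w < index c w).
Proof.
elim: w => //= y w IH xw cx; case: (eqVneq y x) => [->|yx] /=.
  by rewrite eq_sym (negPf cx) subSS subn0.
have {}xw : x \in w by move: xw; rewrite inE eq_sym (negPf yx).
by rewrite IH //; case: eqP => //= _; lia.
Qed.

Lemma rem_insertE (T : eqType) (w : seq T) (x : T) : x \in w ->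
  w = take (index x w) (rem x w) ++ x :: drop (index x w) (rem x w).
Proof.
move=> xw; rewrite remE take_size_cat ?drop_size_cat ?size_takel ?index_size //.
by rewrite -[x in x :: _](nth_index x xw) -drop_nth ?cat_take_drop ?index_mem.
Qed.

(* Since [pos w b] is one more than the last position of a letter below [b], the
   equation [index b w = pos w b] says that all these letters precede [b], one
   of them immediately (or that [b = 0] comes first). *)
Definition pos w b := \max_(c < n | c < b) (index c w).+1.
Definition bad w b := (b \in w) && (index b w == pos w b).
Definition lbad w b := bad w b && [forall (c : 'I_n | c < b), ~~ bad w c].

Lemma eq_pos w w' b :
  (forall c : 'I_n, c < b -> index c w = index c w') -> pos w b = pos w' b.
Proof. by move=> E; apply: eq_bigr => c /E ->. Qed.

Lemma pos_gt w b c : c < b -> index c w < pos w b.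
Proof. exact: (@leq_bigmax_cond _ (fun c : 'I_n => c < b) (fun c => (index c w).+1)). Qed.

Lemma bad_lt w b c : bad w b -> c < b -> index c w < index b w.
Proof.
by case/andP=> _ /eqP->; apply: pos_gt.
Qed.

Lemma bad_mem w b c : bad w b -> c < b -> c \in w.
Proof.
move=> B cb; have := bad_lt B cb; case/andP: B => bw _.
by move: bw; rewrite -!index_mem; lia.
Qed.

Lemma lbad_bad w b : lbad w b -> bad w b.
Proof. by case/andP. Qed.

Lemma lbadN w b c : lbad w b -> c < b -> ~~ bad w c.
Proof. by case/andP=> _ /forall_inP; apply. Qed.

Lemma bad_lbad w b : bad w b -> exists a, lbad w a.
Proof.
move=> B; have [a Ba am] := arg_minnP (fun a : 'I_n => nat_of_ord a) B.
exists a; rewrite /lbad Ba; apply/forall_inP => c ca.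
by apply/negP => /am; lia.
Qed.

Lemma index_lbad w b c : bad w b -> c < b -> index c (rem b w) = index c w.
Proof.
move=> B cb; rewrite index_rem; last by apply: contraTneq cb => ->; lia.
  by have := bad_lt B cb; lia.
by case/andP: B.
Qed.

(** The place of the deleted letter can be read off from the shorter word; this makes the deletion
    invertible. *)
Lemma pos_lbad w b : bad w b -> pos (rem b w) b = index b w.
Proof.
move=> B; case/andP: (B) => _ /eqP->; apply: eq_pos => c; exact: index_lbad.
Qed.

Lemma mem_rem_neq w b c : uniq w -> (c \in rem b w) = (c != b) && (c \in w).
Proof. by move=> uw; rewrite mem_rem_uniq. Qed.

(** Letters below [b] keep their positions, so a bad one would already be bad in [w]; a bad letter
    above [b] would require [b] to be present. *)
Lemma rem_lbad_not_bad w b c : uniq w -> lbad w b -> ~~ bad (rem b w) c.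
Proof.
move=> uw L; have B := lbad_bad L; have bw : b \in w by case/andP: B.
case: (ltngtP c b) => [cb|bc|/val_inj->].
- have E (d : 'I_n) : d <= c -> index d (rem b w) = index d w.
    by move=> dc; apply: index_lbad => //; lia.
  rewrite /bad E // mem_rem_neq // (@eq_pos _ w) => [|d dc]; last by apply: E; lia.
  by apply: contra (lbadN L cb) => /andP[/andP[_ cw]]; rewrite /bad cw.
- apply/negP=> /bad_mem - /(_ b bc).
  by rewrite mem_rem_neq // eqxx.
- by rewrite /bad mem_rem_neq // eqxx.
Qed.

(** If [x1 < x2], badness of [x2] puts [x1] in [w2], hence in [rem x2 w2], whereas [rem x1 w1] lacks
    it. So the deleted letters agree, and [pos_lbad] recovers their place. *)
Lemma rem_lbad_inj w1 w2 x1 x2 : uniq w1 -> uniq w2 ->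
  lbad w1 x1 -> lbad w2 x2 -> rem x1 w1 = rem x2 w2 -> w1 = w2.
Proof.
have le v1 v2 y1 y2 : uniq v1 -> bad v1 y1 -> bad v2 y2 -> rem y1 v1 = rem y2 v2 ->
    uniq v2 -> y2 <= y1.
  move=> u1 B1 B2 E u2; case: (ltnP y1 y2) => // lt.
  have := mem_rem_neq y2 y1 u2.
  rewrite -E mem_rem_neq // eqxx (bad_mem B2 lt) andbT.
  by move/esym/negbFE/eqP => E'; move: lt; rewrite E'; lia.
move=> u1 u2 /lbad_bad B1 /lbad_bad B2 E.
have ex : x1 = x2.
  by apply/val_inj/eqP; rewrite eqn_leq (le _ _ _ _ u2 B2 B1) // (le _ _ _ _ u1 B1 B2).
move: B2 E; rewrite -ex => B2 E.
case/andP: (B1) => m1 _; case/andP: (B2) => m2 _.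
rewrite (rem_insertE m1) (rem_insertE m2) E.
by rewrite -(pos_lbad B1) -(pos_lbad B2) E.
Qed.

(** The deletion spares [a] and all smaller letters, in particular the one just before [a], if
    any. *)
Lemma rem_bad_gt w a y : bad w a -> y \in w -> a < y -> bad (rem y w) a.
Proof.
move=> B yw ay; case/andP: (B) => aw /eqP pa.
have ny (c : 'I_n) : c <= a -> c != y by move=> ca; apply: contraTneq ca => ->; lia.
have I (c : 'I_n) : c <= a -> index c (rem y w) = index c w - (index y w < index c w).
  by move=> ca; rewrite index_rem // ny.
have ne (c : 'I_n) : c <= a -> index c w != index y w.
  move=> ca; apply: contraNneq (ny c ca) => E.
  have cw : c \in w by rewrite -index_mem E index_mem.
  by rewrite -(nth_index c cw) -(nth_index c yw) E.
rewrite /bad I // -[X in X && _]index_mem I // size_rem //; apply/andP; split.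
  by move: aw yw (ne a (leqnn a)); rewrite -!index_mem; lia.
rewrite eqn_leq; apply/andP; split; last first.
  apply/bigmax_leqP => c ca; rewrite (I _ (ltnW ca)).
  by move: (bad_lt B ca) (ne c (ltnW ca)) (ne a (leqnn a)); lia.
have [/eqP a0|a0] := boolP (index a w == 0); first by rewrite a0.
have [c ca Ec] : exists2 c : 'I_n, c < a & index a w = (index c w).+1.
  move: a0; rewrite pa; case: (pickP (fun c : 'I_n => c < a)) => [c0 c0a _|no]; last first.
    by rewrite /pos big_pred0.
  rewrite /pos; have [|c ca E] := eq_bigmax_cond (fun c => (index c w).+1) (A := [pred c : 'I_n | c < a]).
    by apply/card_gt0P; exists c0.
  by exists c.
by move: (pos_gt (rem y w) ca) (ne a (leqnn a)) (ne c (ltnW ca)); rewrite (I _ (ltnW ca)); lia.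
Qed.

(* If [rem y w] is also obtained from [w2], then [y] is the least letter missing
   from it and is less than [a].  The first letter in alphabetical order at or
   after the position of [y] in [w] moves to the left in [w2]. *)
Lemma rem_lbad_lex w w2 a x y : uniq w -> uniq w2 -> lbad w a -> lbad w2 x ->
  y \in w -> rem y w = rem x w2 -> w2 != w ->
  exists b : 'I_n, (forall c : 'I_n, c < b -> index c w2 = index c w) /\ index b w2 < index b w.
Proof.
move=> uw u2 La Lx yw E ne; have Ba := lbad_bad La; have Bx := lbad_bad Lx.
(* Deleting [a] itself would give [w2 = w]; deleting a larger letter would leave [a] bad, but
   [rem x w2] has no bad letter. *)
have ya : y < a.
  rewrite ltnNge; apply/negP; rewrite leq_eqVlt => /orP[/eqP/val_inj ay|ay].
    by move/negP: ne; apply; rewrite eq_sym (rem_lbad_inj uw u2 La Lx) // ay.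
  by move: (rem_bad_gt Ba yw ay); rewrite E; apply/negP/rem_lbad_not_bad.
have xy : y = x.
  case: (ltngtP y x) => [lt|lt|/val_inj//].
    have := mem_rem_neq y y uw.
    rewrite E mem_rem_neq // eqxx (bad_mem Bx lt) andbT /= => /negbFE/eqP yx.
    by move: lt; rewrite yx; lia.
  have := mem_rem_neq x x u2.
  rewrite -E mem_rem_neq // eqxx (bad_mem Ba) /=; last by lia.
  by rewrite andbT => /negbFE/eqP yx; move: lt; rewrite yx; lia.
subst y.
pose P (b : 'I_n) := index x w <= index b w.
have Px : P x by rewrite /P.
have [b [Pb bm]] : exists b : 'I_n, P b /\ forall c : 'I_n, P c -> b <= c.
  by have [b Pb bm] := arg_minnP (fun c : 'I_n => nat_of_ord c) Px; exists b.
have bx : b <= x by apply: bm.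
have I2 (c : 'I_n) : c < x -> index c w2 = index c w - (index x w < index c w).
  move=> cx; rewrite -(index_lbad Bx cx) -E index_rem //.
  by apply: contraTneq cx => ->; lia.
have lt (c : 'I_n) : c < b -> index c w < index x w.
  by move=> cb; rewrite ltnNge; apply/negP => /bm; lia.
exists b; split=> [c cb|]; first by rewrite I2; move: (lt c cb); lia.
rewrite ltn_neqAle; move: bx; rewrite leq_eqVlt => /orP[/eqP/val_inj bx|bx]; last first.
  have nxb : index x w != index b w.
    apply: contraTneq bx => exb; have bw : b \in w by rewrite -index_mem -exb index_mem.
    by rewrite -(nth_index b bw) -exb (nth_index b yw) ltnn.
  by rewrite I2 //; move: Pb nxb; rewrite /P; lia.
(* In the case [b = x], all letters below [x] lie before the place of [x] in [w], so [x] sits no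
   later in [w2]; the same place would give [w2 = w]. *)
subst b; case/andP: (Bx) => x2 /eqP p2; apply/andP; split.
  apply: contra ne => /eqP ex; apply/eqP.
  by rewrite (rem_insertE yw) (rem_insertE x2) E ex.
rewrite p2; apply/bigmax_leqP => c cx; rewrite I2 //.
by move: (lt c cx); lia.
Qed.

Lemma not_bad_rem_lbad w : uniq w -> size w < n -> (forall b, ~~ bad w b) ->
  exists v x, [/\ uniq v, lbad v x, size v = (size w).+1 & rem x v = w].
Proof.
move=> uw sw nb.
have [x0 x0w] : exists x, x \notin w.
  apply/existsP; rewrite -negb_forall; apply: contraL sw => /forallP all.
  rewrite -leqNgt -[n in n <= _]card_ord -(card_uniqP uw).
  by apply: subset_leq_card; apply/subsetP => c _; exact: all.
have [x xw xm] := arg_minnP (P := fun x => x \notin w) (fun a : 'I_n => nat_of_ord a) x0w.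
(* [x] is the least missing letter; it is inserted right after the last letter
   below it. *)
have mw (c : 'I_n) : c < x -> c \in w by move=> cx; apply/negPn/negP => /xm; lia.
pose i := pos w x.
have is_ : i <= size w by apply/bigmax_leqP => c /mw; rewrite index_mem.
pose v := take i w ++ x :: drop i w.
have xv : index x v = i.
  rewrite index_cat ifN ?size_takel //= ?eqxx ?addn0 //.
  by apply: contra xw => /mem_take.
have pv : perm_eq v (x :: w).
  by rewrite perm_catC /= perm_cons perm_catC cat_take_drop.
have uv : uniq v by rewrite (perm_uniq pv) /= xw.
have mv c : (c \in v) = (c == x) || (c \in w) by rewrite (perm_mem pv) inE.
have rv : rem x v = w.
  by rewrite remE xv /v take_size_cat ?size_takel // -cat_rcons drop_size_cat
     ?cat_take_drop // size_rcons size_takel.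
have I (c : 'I_n) : c < x -> index c v = index c w.
  move=> cx; have ci : index c w < i by apply: pos_gt.
  move: ci; rewrite -rv index_rem ?xv ?mv ?eqxx //; first by lia.
  by apply: contraTneq cx => ->; lia.
exists v, x; split=> //; last by rewrite (perm_size pv).
apply/andP; split; first by rewrite /bad mv eqxx xv (@eq_pos _ w) //=.
apply/forall_inP => c cx; rewrite /bad mv I // (@eq_pos _ w) => [|d dc]; last first.
  by apply: I; lia.
apply: contra (nb c); rewrite /bad (mw c cx) => /andP[_ ->]; exact: isT.
Qed.

(* The value in base [n.+1] of the digits [q 0, ..., q m.-1], the first one being
   the most significant. *)
Fixpoint digits (q : nat -> nat) (m : nat) : nat :=
  if m is k.+1 then digits q k * n.+1 + q k else 0.

(** The digits of [q'] stay below the base, so appended digits cannot make up for a strict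
    inequality already reached. *)
Lemma digits_lex (q q' : nat -> nat) b m :
  (forall j, q' j <= n) -> (forall j, j < b -> q' j = q j) -> q' b < q b ->
  b < m -> digits q' m < digits q m.
Proof.
move=> bd E lt; elim: m => // m IH; rewrite ltnS leq_eqVlt => /orP[/eqP<-|bm] /=.
  suff -> : forall k, k <= b -> digits q' k = digits q k by rewrite ?ltn_add2l.
  by elim=> //= k IHk kb; rewrite IHk ?E // ltnW.
by have := IH bm; have := bd m; nia.
Qed.

Definition rank w := digits (fun j => index j (map val w)) n.

Lemma rank_lex w w2 (b : 'I_n) : uniq w2 ->
  (forall c : 'I_n, c < b -> index c w2 = index c w) -> index b w2 < index b w ->
  rank w2 < rank w.
Proof.
move=> u2 E lt; apply: (@digits_lex _ _ b) => // [j|j jb|].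
- rewrite (leq_trans (index_size _ _)) // size_map -(card_uniqP u2).
  by rewrite -[n in _ <= n]card_ord max_card.
- have jn : j < n by apply: ltn_trans jb _.
  by have := E (Ordinal jn) jb; rewrite -!(index_map val_inj).
- by rewrite !(index_map val_inj).
Qed.

Lemma rem_lbad_rank w w2 a x y : uniq w -> uniq w2 -> lbad w a -> lbad w2 x ->
  y \in w -> rem y w = rem x w2 -> w2 != w -> rank w2 < rank w.
Proof.
move=> uw u2 La Lx yw E ne; have [b [Eb lt]] := rem_lbad_lex uw u2 La Lx yw E ne.
exact: (rank_lex u2 Eb lt).
Qed.

End Words.

(** * Triangular matchings *)

Section Triangular.
Variables (R : comNzRingType) (X Y : finType) (c : X -> Y -> R).
Variables (D : pred X) (U : pred Y) (N : X -> Y -> bool) (r : X -> nat).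
Hypothesis N_onto : forall y, U y -> exists2 x, D x & N x y.
Hypothesis N_total : forall x, D x -> exists2 y, U y & N x y.
Hypothesis N_functional : forall x y y', N x y -> N x y' -> y = y'.
(** An entry with square 1 is its own inverse, which allows elimination over any [R]. *)
Hypothesis N_unit : forall x y, D x -> N x y -> c x y * c x y = 1.
Hypothesis N_rank : forall x x2 y,
  D x -> D x2 -> N x2 y -> c x y != 0 -> x2 != x -> (r x2 < r x)%N.

(** At an [x] of largest rank with [v x] nonzero, [N_rank] rules out every other contribution to the
    column of its partner, and the unit entry forces [v x = 0]. *)
Lemma triangular_inj (v : X -> R) : (forall x, ~~ D x -> v x = 0) ->
  (forall y, U y -> \sum_x v x * c x y = 0) -> forall x, v x = 0.
Proof.
move=> vD dv0 x0; apply/eqP/negPn/negP => vx0.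
have [x vx xm] := arg_maxnP r (P := fun x => v x != 0) vx0.
have Dx : D x by apply: contraNT vx => /vD->.
have [y Uy Nxy] := N_total Dx.
move: (dv0 y Uy); rewrite (bigD1 x) //= big1 ?addr0 => [E|x' ne].
  by move/eqP: vx; apply; rewrite -[v x]mulr1 -(N_unit Dx Nxy) mulrA E mul0r.
have [->|vx'] := eqVneq (v x') 0; first by rewrite mul0r.
have [->|cx'] := eqVneq (c x' y) 0; first by rewrite mulr0.
have Dx' : D x' by apply: contraNT vx' => /vD->.
have := N_rank Dx' Dx Nxy cx'; rewrite eq_sym ne => /(_ isT).
by have := xm x' vx'; rewrite /=; lia.
Qed.

(* Induction on the largest rank [m] of an [x] whose partner carries a nonzero
   target value: correcting [z] at the partners of rank [m] only creates values
   at partners of smaller rank. *)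
Lemma triangular_surj (z : Y -> R) : exists v : X -> R,
  (forall x, ~~ D x -> v x = 0) /\ forall y, U y -> \sum_x v x * c x y = z y.
Proof.
(* [M] exceeds all ranks, so the induction starts from a vacuous condition. *)
pose M := (\max_x r x).+1.
have : forall x y, D x -> U y -> N x y -> (M <= r x)%N -> z y = 0.
  by move=> x y _ _ _; rewrite /M ltnNge (leq_bigmax x).
elim: M z => [|m IH] z z0.
  exists (fun=> 0); split=> // y Uy; rewrite big1 => [|x _]; last by rewrite mul0r.
  by have [x Dx Nxy] := N_onto Uy; rewrite (z0 x).
(* As [c x y] is its own inverse, this is [z y / c x y] at the unique partner [y] of [x]. *)
pose v0 x := if D x && (r x == m) then \sum_(y | N x y) c x y * z y else 0.
have v0N x y : D x -> N x y -> r x = m -> v0 x = c x y * z y.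
  move=> Dx Nxy rx; rewrite /v0 Dx rx eqxx /= (bigD1 y) //= big1 ?addr0 //.
  by move=> y' /andP[Nxy' /eqP]; case; exact: N_functional Nxy' Nxy.
have [|v1 [v1D v1z]] := IH (fun y => z y - \sum_x v0 x * c x y).
  move=> x y Dx Uy Nxy; rewrite leq_eqVlt => rx.
  rewrite (bigD1 x) //= big1 ?addr0 => [|x' ne]; last first.
    rewrite /v0; case: ifP => [/andP[Dx' /eqP rx']|]; last by rewrite mul0r.
    have [->|cx'] := eqVneq (c x' y) 0; first by rewrite mulr0.
    have := N_rank Dx' Dx Nxy cx'; rewrite eq_sym ne => /(_ isT).
    by move: rx; rewrite rx'; lia.
  case/orP: rx => [/eqP rx|rx].
    by rewrite (v0N x y) // mulrAC N_unit // mul1r subrr.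
  by rewrite (z0 x) // /v0 gtn_eqF // andbF mul0r subr0.
exists (fun x => v0 x + v1 x); split=> [x nDx|y Uy].
  by rewrite v1D // /v0 (negPf nDx) addr0.
under eq_bigr do rewrite mulrDl.
by rewrite big_split /= v1z // addrC subrK.
Qed.

End Triangular.

(** * Signed incidences between words and their one-letter deletions *)

Section Incidence.
Variable R : comNzRingType.

(** Unlike [delete], this reaches the empty word, so that the augmentation becomes one more
    boundary. *)
Definition del (T : finType) k (i : 'I_k.+1) (x : k.+1.-tuple T) : k.-tuple T :=
  [tuple tnth x (lift i j) | j < k].

Definition inc (T : finType) k (x : k.+1.-tuple T) (y : k.-tuple T) : R :=
  \sum_(i < k.+1) (-1) ^+ i * (y == del i x)%:R.

Lemma bdE (T : finType) m (v : Lambda R T m.+1) y :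
  bd v y = \sum_x v x * inc x y.
Proof.
rewrite /bd sum_ffunE; apply: eq_bigr => x _.
rewrite sum_ffunE mulr_sumr; apply: eq_bigr => i _.
by rewrite !ffunE.
Qed.

Lemma inc0 (T : finType) (x : 1.-tuple T) (y : 0.-tuple T) : inc x y = 1.
Proof. by rewrite /inc big_ord1 mul1r [y]tuple0 [del _ _]tuple0 eqxx. Qed.

Lemma inc_inc (T : finType) k (x : k.+2.-tuple T) (t : k.-tuple T) :
  \sum_y inc x y * inc y t = 0.
Proof.
case: k x t => [|k] x t.
  under eq_bigr do rewrite inc0 mulr1.
  rewrite exchange_big /=.
  have E (i : 'I_2) : \sum_y (-1) ^+ i * (y == del i x)%:R = (-1) ^+ i :> R.
    rewrite (bigD1 (del i x)) //= eqxx mulr1 big1 ?addr0 // => y /negPf->.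
    by rewrite mulr0.
  under eq_bigr do rewrite E.
  by rewrite !big_ord_recl big_ord0 expr0 expr1 addr0 subrr.
have := bd_bd (basis R x) => /(congr1 (fun f : Lambda R T k => f t)).
rewrite bdE [RHS]ffunE => E; rewrite -[RHS]E; apply: eq_bigr => y _.
congr (_ * _); rewrite bdE (bigD1 x) //= ffunE eqxx mul1r big1 ?addr0 //.
by move=> x' /negPf xx; rewrite ffunE xx mul0r.
Qed.

Lemma val_del (T : finType) k (i : 'I_k.+1) (x : k.+1.-tuple T) :
  uniq x -> del i x = rem (tnth x i) x :> seq T.
Proof.
move=> ux; have E : size (rem (tnth x i) x) = k by rewrite size_rem ?mem_tnth ?size_tuple.
apply: (@eq_from_nth _ (tnth x i)); rewrite size_tuple // => j jk.
rewrite -[j]/(nat_of_ord (Ordinal jk)) -tnth_nth tnth_mktuple.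
rewrite remE (tnth_nth (tnth x i)) [X in index X _](tnth_nth (tnth x i)).
rewrite index_uniq ?size_tuple ?ltn_ord // nth_cat size_takel ?size_tuple ?(ltnW (ltn_ord i)) //=.
rewrite /bump leqNgt; case: ltnP => ji /=; first by rewrite nth_take.
by rewrite nth_drop; congr nth; lia.
Qed.

Lemma rem_inj (T : eqType) (w : seq T) (a b : T) : uniq w -> a \in w -> b \in w ->
  rem a w = rem b w -> a = b.
Proof.
move=> uw aw bw E; apply/eqP/negPn/negP => ab.
by have := mem_rem_uniqF a uw; rewrite E mem_rem_uniq // inE /= aw ab.
Qed.

(** Deleting distinct letters of a word without repetition gives distinct words, so one summand
    survives. *)
Lemma inc_rem (T : finType) k (x : k.+1.-tuple T) (y : k.-tuple T) a :
  uniq x -> a \in x -> rem a x = y -> inc x y = (-1) ^+ index a x.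
Proof.
move=> ux ax E; have ix : (index a x < k.+1)%N by move: ax; rewrite -index_mem size_tuple.
have ta : tnth x (Ordinal ix) = a by rewrite (tnth_nth a) nth_index.
rewrite /inc (bigD1 (Ordinal ix)) //= big1 ?addr0 => [|i ne].
  suff -> : y = del (Ordinal ix) x by rewrite eqxx mulr1.
  by apply: val_inj; rewrite /= val_del // ta E.
have [e|_] := eqVneq y (del i x); last by rewrite mulr0.
case/eqP: ne; apply: val_inj => /=.
have : rem a x = rem (tnth x i) x by rewrite E e val_del.
by move/(rem_inj ux ax (mem_tnth _ _)) => ->; rewrite (tnth_nth a) index_uniq ?size_tuple.
Qed.

Lemma inc_neq0 (T : finType) k (x : k.+1.-tuple T) (y : k.-tuple T) :
  uniq x -> inc x y != 0 -> exists2 a, a \in x & rem a x = y.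
Proof.
move=> ux nz; have [i /eqP->|no] := pickP (fun i => y == del i x).
  by exists (tnth x i); rewrite ?mem_tnth ?val_del.
by move/eqP: nz; case; apply: big1 => i _; rewrite no mulr0.
Qed.

Lemma inc_uniq0 (T : finType) k (x : k.+1.-tuple T) (y : k.-tuple T) :
  uniq x -> ~~ uniq y -> inc x y = 0.
Proof.
move=> ux; apply: contraNeq => /(inc_neq0 ux)[a ax <-]; exact: rem_uniq.
Qed.

End Incidence.

(** * The complex of injective words *)

Section InjectiveWords.
Variables (R : comNzRingType) (n : nat).
Notation T := ('I_n).
Notation inc := (@inc R T _).

Definition down k (x : k.-tuple T) := uniq x && [exists b, bad x b].
Definition up k (y : k.-tuple T) := [&& uniq y, (k < n)%N & ~~ [exists b, bad y b]].
(** Below length [n] these are the [up] words; at length [n] they are exactly the unmatched ones. *)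
Definition crit k (x : k.-tuple T) := uniq x && ~~ [exists b, bad x b].
Definition matched k (x : k.+1.-tuple T) (y : k.-tuple T) :=
  [exists a, lbad x a && (rem a x == y)].

Lemma matched_onto k (y : k.-tuple T) : up y -> exists2 x, down x & matched x y.
Proof.
case/and3P=> uy kn /existsPn nb.
have [|v [x [uv Lx sv E]]] := not_bad_rem_lbad uy _ nb; first by rewrite size_tuple.
have sv' : size v == k.+1 by rewrite sv size_tuple.
exists (Tuple sv'); first by rewrite /down uv; apply/existsP; exists x; exact: lbad_bad.
by apply/existsP; exists x; rewrite Lx E eqxx.
Qed.

Lemma uniq_size_le (w : seq T) : uniq w -> (size w <= n)%N.
Proof. by move=> uw; rewrite -(card_uniqP uw) -[n in (_ <= n)%N]card_ord max_card. Qed.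

Lemma matched_total k (x : k.+1.-tuple T) : down x -> exists2 y, up y & matched x y.
Proof.
case/andP=> ux /existsP[b /bad_lbad[a La]].
have ax : a \in val x by case/andP: (lbad_bad La).
have sr : size (rem a x) == k by rewrite size_rem // size_tuple.
exists (Tuple sr); last by apply/existsP; exists a; rewrite La eqxx.
apply/and3P; split; first exact: rem_uniq.
  by have := uniq_size_le ux; rewrite size_tuple.
by apply/existsPn => c; exact: rem_lbad_not_bad.
Qed.

Lemma lbad_unique (w : seq T) a b : lbad w a -> lbad w b -> a = b.
Proof.
move=> La Lb; case: (ltngtP a b) => [lt|lt|/val_inj//].
  by have := lbadN Lb lt; rewrite lbad_bad.
by have := lbadN La lt; rewrite lbad_bad.
Qed.

Lemma matched_functional k (x : k.+1.-tuple T) (y y' : k.-tuple T) :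
  matched x y -> matched x y' -> y = y'.
Proof.
case/existsP=> a /andP[La /eqP E] /existsP[a' /andP[La' /eqP E']].
by apply: val_inj; rewrite /= -E -E' (lbad_unique La La').
Qed.

Lemma matched_unit k (x : k.+1.-tuple T) (y : k.-tuple T) :
  down x -> matched x y -> inc x y * inc x y = 1.
Proof.
case/andP=> ux _ /existsP[a /andP[La /eqP E]].
have ax : a \in val x by case/andP: (lbad_bad La).
by rewrite (inc_rem R ux ax E) -expr2 sqrr_sign.
Qed.

Lemma matched_rank k (x x2 : k.+1.-tuple T) (y : k.-tuple T) :
  down x -> down x2 -> matched x2 y -> inc x y != 0 -> x2 != x ->
  (rank x2 < rank x)%N.
Proof.
case/andP=> ux /existsP[b /bad_lbad[a La]] /andP[u2 _].
case/existsP=> c /andP[Lc /eqP E] /(inc_neq0 ux)[d dx E'] ne.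
by apply: (rem_lbad_rank ux u2 La Lc dx) => //; rewrite E E'.
Qed.

Lemma down_inj k (v : k.+1.-tuple T -> R) : (forall x, ~~ down x -> v x = 0) ->
  (forall y, up y -> \sum_x v x * inc x y = 0) -> forall x, v x = 0.
Proof.
exact: (triangular_inj (@matched_total k) (@matched_unit k)
  (@matched_rank k)).
Qed.

Lemma down_surj k (z : k.-tuple T -> R) : exists v : k.+1.-tuple T -> R,
  (forall x, ~~ down x -> v x = 0) /\ forall y, up y -> \sum_x v x * inc x y = z y.
Proof.
exact: (triangular_surj (@matched_onto k) (@matched_functional k)
  (@matched_unit k) (@matched_rank k)).
Qed.

Lemma inc_inc_sum k (v : k.+2.-tuple T -> R) (t : k.-tuple T) :
  \sum_y (\sum_x v x * inc x y) * inc y t = 0.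
Proof.
under eq_bigr do rewrite mulr_suml.
rewrite exchange_big big1 //= => x _.
under eq_bigr do rewrite -mulrA.
by rewrite -mulr_sumr inc_inc mulr0.
Qed.

Lemma boundary_uniq k (v : k.+1.-tuple T -> R) (y : k.-tuple T) :
  (forall x : k.+1.-tuple T, ~~ uniq x -> v x = 0) -> ~~ uniq y -> \sum_x v x * inc x y = 0.
Proof.
move=> vu uy; apply: big1 => x _; have [ux|ux] := boolP (uniq x).
  by rewrite inc_uniq0 ?mulr0.
by rewrite vu ?mul0r.
Qed.

Lemma down_cycle0 k (z : k.+1.-tuple T -> R) : (forall x, ~~ down x -> z x = 0) ->
  (forall y, \sum_x z x * inc x y = 0) -> forall x, z x = 0.
Proof. by move=> zD zc; apply: down_inj. Qed.

(* Every chain on the empty word counts as a cycle: the complex is augmented. *)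
Definition word_cycle k : (k.-tuple T -> R) -> Prop :=
  if k is k'.+1 then fun z => forall y : k'.-tuple T, \sum_x z x * inc x y = 0
  else fun=> True.

(** Such a cycle lives on [down] words, where [down_inj] applies; in length 0 the empty word is
    itself [up]. *)
Lemma cycle_up0 k (z : k.-tuple T -> R) : (k < n)%N ->
  (forall x : k.-tuple T, ~~ uniq x -> z x = 0) -> word_cycle z ->
  (forall x, up x -> z x = 0) -> forall x, z x = 0.
Proof.
case: k z => [|k] z kn zu zc zU x.
  by apply: zU; rewrite [x]tuple0 /up kn; apply/existsPn.
apply: down_cycle0 zc x => x ndx.
have [ux|ux] := boolP (uniq x); last exact: zu.
by apply: zU; rewrite /up ux kn; move: ndx; rewrite /down ux.
Qed.

Lemma cycleB k (z z' : k.-tuple T -> R) : word_cycle z -> word_cycle z' ->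
  word_cycle (fun x => z x - z' x).
Proof.
case: k z z' => //= k z z' zc zc' y.
by under eq_bigr do rewrite mulrBl; rewrite sumrB zc zc' subrr.
Qed.

Lemma cycle_boundary k (v : k.+1.-tuple T -> R) :
  word_cycle (fun y => \sum_x v x * inc x y).
Proof. case: k v => //= k v t; exact: inc_inc_sum. Qed.

(** [down_surj] solves the equation on [up] words; the discrepancy is a cycle vanishing there, hence
    zero by [cycle_up0]. *)
Lemma words_exact k (z : k.-tuple T -> R) : (k < n)%N ->
  (forall x : k.-tuple T, ~~ uniq x -> z x = 0) -> word_cycle z ->
  exists v : k.+1.-tuple T -> R, (forall x : k.+1.-tuple T, ~~ uniq x -> v x = 0) /\
    forall y, \sum_x v x * inc x y = z y.
Proof.
move=> kn zu zc; have [v [vD vz]] := down_surj z.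
have vu (x : k.+1.-tuple T) : ~~ uniq x -> v x = 0.
  by move=> nu; apply: vD; rewrite /down (negPf nu).
exists v; split=> // y; apply/eqP; rewrite -subr_eq0; apply/eqP; move: y.
apply: cycle_up0 => // [y uy||y uy].
- by rewrite zu // boundary_uniq // subrr.
- by apply: cycleB => //; exact: cycle_boundary.
- by rewrite vz ?subrr.
Qed.

(** A chain on [down] words, which leaves the critical coefficients alone, cancels the boundary of
    [w] on [up] words; what remains of the boundary is zero by [cycle_up0]. *)
Lemma crit_cycle k (w : k.+1.-tuple T) : (k < n)%N -> crit w ->
  exists v : k.+1.-tuple T -> R,
    [/\ forall x : k.+1.-tuple T, ~~ uniq x -> v x = 0, word_cycle v &
        forall x, crit x -> v x = (x == w)%:R].
Proof.
move=> kn cw; have [v [vD vz]] := down_surj (fun y => - inc w y).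
have vu (x : k.+1.-tuple T) : ~~ uniq x -> (x == w)%:R + v x = 0.
  move=> nu; rewrite vD ?addr0; last by rewrite /down (negPf nu).
  by case: eqP nu => // ->; case/andP: cw => ->.
exists (fun x => (x == w)%:R + v x); split=> //=.
- apply: cycle_up0 => // [y||y uy]; first exact: boundary_uniq.
    exact: cycle_boundary.
  under eq_bigr do rewrite mulrDl.
  rewrite big_split /= vz // (bigD1 w) //= eqxx mul1r big1 ?addr0 ?subrr //.
  by move=> x /negPf->; rewrite mul0r.
- move=> x /andP[ux nb]; rewrite vD ?addr0 //.
  by rewrite /down (negPf nb) andbF.
Qed.

Lemma cycle_crit0 k (z : k.+1.-tuple T -> R) :
  (forall x : k.+1.-tuple T, ~~ uniq x -> z x = 0) -> word_cycle z ->
  (forall x, crit x -> z x = 0) -> forall x, z x = 0.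
Proof.
move=> zu zc zC; apply: down_cycle0 zc => x ndx.
have [ux|ux] := boolP (uniq x); last exact: zu.
by apply: zC; rewrite /crit ux; move: ndx; rewrite /down ux.
Qed.

End InjectiveWords.

(** * Counting *)

Section Counting.
Variable n : nat.
Notation T := ('I_n).

Local Open Scope nat_scope.

Lemma card_up_down k : #|@up n k| = #|@down n k.+1|.
Proof.
pose f (x : k.+1.-tuple T) : k.-tuple T := odflt (del ord0 x) [pick y | matched x y].
have fP x y : matched x y -> f x = y.
  move=> Nxy; rewrite /f; case: pickP => [y' Nxy'|/(_ y)]; last by rewrite Nxy.
  exact: matched_functional Nxy' Nxy.
rewrite -[RHS](card_in_image (f := f)) => [|x x' Dx Dx' E].
  apply: eq_card => y; apply/idP/imageP => [/matched_onto[x Dx Nxy]|[x Dx ->]].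
    by exists x => //; rewrite (fP _ _ Nxy).
  by have [y' Uy' Nxy'] := matched_total Dx; rewrite (fP _ _ Nxy').
have [y _ Nxy] := matched_total Dx; have [y' _ Nxy'] := matched_total Dx'.
move: E; rewrite (fP _ _ Nxy) (fP _ _ Nxy') => E; subst y'.
case/existsP: Nxy => a /andP[La /eqP Ea]; case/existsP: Nxy' => b /andP[Lb /eqP Eb].
case/andP: Dx => ux _; case/andP: Dx' => ux' _.
by apply/val_inj/(rem_lbad_inj ux ux' La Lb); rewrite Ea Eb.
Qed.

Lemma card_uniq_split k : n ^_ k = #|@crit n k| + #|@down n k|.
Proof.
rewrite -[n in LHS]card_ord -(card_uniq_tuples k predT).
rewrite -sum1_card (bigID (fun x : k.-tuple T => [exists b, bad x b])) /= addnC.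
congr (_ + _); rewrite -sum1_card; apply: eq_bigl => x; rewrite !inE all_predT;
  by rewrite ?unfold_in /= /crit /down.
Qed.

Lemma card_crit_up k : k < n -> #|@crit n k| = #|@up n k|.
Proof. by move=> kn; apply: eq_card => x; rewrite !unfold_in /crit /up kn. Qed.

End Counting.

(** The indicator of derangements is the product of the [1 - (s i == i)]; in its expansion the
    subset [A] counts the permutations fixing [A] pointwise, [(n - #|A|)!] in number. *)
Lemma card_derangements n : #|derangements n|%:R =
  \sum_(j < n.+1) (-1) ^+ j * (n ^_ (n - j))%:R :> rat.
Proof.
have derE (s : 'S_n) : (s \in derangements n)%:R =
    \sum_(A : {set 'I_n}) (-1) ^+ #|A| * (perm_on (~: A) s)%:R :> rat.
  have -> : (s \in derangements n)%:R =
      \prod_i (- (s i == i)%:R + 1) :> rat.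
    rewrite inE; have [/forallP sd|/forallPn[i]] := boolP [forall i, s i != i].
      by rewrite big1 // => i _; rewrite (negPf (sd i)) oppr0 add0r.
    by rewrite negbK => si; rewrite (bigD1 i) //= si addNr mul0r.
  rewrite bigA_distr; apply: eq_bigr => A _.
  rewrite -big_mkcond /= prodrN; congr (_ * _).
  have [sA|] := boolP (perm_on (~: A) s).
    by rewrite big1 // => i iA; rewrite (out_perm sA) ?eqxx // inE negbK.
  case/subsetPn => i; rewrite !inE negbK => si iA.
  by rewrite (bigD1 i) //= (negPf si) mul0r.
rewrite -sum1_card natr_sum big_mkcond /=.
under eq_bigr => s _.
  rewrite (_ : (if _ then _ else _) = (s \in derangements n)%:R); last by case: ifP.
  rewrite derE; over.
rewrite exchange_big /=.
have E (A : {set 'I_n}) : \sum_(s : 'S_n) (-1) ^+ #|A| * (perm_on (~: A) s)%:R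
    = (-1) ^+ #|A| * (n - #|A|)`!%:R :> rat.
  rewrite -mulr_sumr -[(n - _)%N](_ : #|~: A| = _); last first.
    by have := cardsC A; rewrite card_ord; lia.
  rewrite -card_perm -[#|perm_on _|]sum1_card natr_sum [in RHS]big_mkcond; congr (_ * _).
  by apply: eq_bigr => s _; rewrite /in_mem /=; case: (perm_on _ s).
under eq_bigr do rewrite E.
have cle (A : {set 'I_n}) : (#|A| < n.+1)%N by have := max_card A; rewrite card_ord ltnS.
rewrite (partition_big (fun A => Ordinal (cle A)) predT) //=; apply: eq_bigr => j _.
rewrite (eq_bigr (fun=> (-1) ^+ j * (n - j)`!%:R)); last by move=> A /eqP <-.
rewrite sumr_const -[LHS]mulr_natr -mulrA; congr (_ * _).
rewrite -natrM mulnC; congr (_%:R).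
have -> : #|[pred A | Ordinal (cle A) == j]| = 'C(n, n - j).
  have jn : (j <= n)%N by rewrite -ltnS.
  rewrite bin_sub // -[X in 'C(X, _)](card_ord n) -card_draws.
  by apply: eq_card => A; rewrite !inE.
by rewrite bin_ffact.
Qed.

(** By [card_uniq_split] and the matching, the critical words of length [k > 0] number [n ^_ k]
    minus those of length [k - 1]. *)
Lemma card_crit n : #|@crit n n|%:R =
  \sum_(j < n.+1) (-1) ^+ j * (n ^_ (n - j))%:R :> rat.
Proof.
have S k : (k <= n)%N -> #|@crit n k|%:R = \sum_(j < k.+1) (-1) ^+ j * (n ^_ (k - j))%:R :> rat.
  elim: k => [|k IH] kn.
    rewrite big_ord1 mul1r card_uniq_split [#|@down n 0|]eq_card0 ?addn0 //.
    move=> x; rewrite unfold_in /down [x]tuple0; apply/negbTE/negP.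
    by case/andP=> _ /existsP[b].
  rewrite big_ord_recl mul1r /= subn0 card_uniq_split -card_up_down -card_crit_up //.
  rewrite natrD IH 1?ltnW // -[LHS]addr0 -addrA; congr (_ + _).
  rewrite -big_split /= big1 ?addr0 // => i _.
  by rewrite /bump /= add1n subSS exprS mulN1r mulNr subrr.
exact: S.
Qed.

Lemma card_derangements_crit n : #|derangements n| = #|@crit n n|.
Proof.
by apply/eqP; rewrite -(eqr_nat rat) card_derangements card_crit.
Qed.

Lemma card_derangements_fact n : #|derangements n|%:R
  = \sum_(0 <= j < n.+1) (-1) ^+ j * (n`!%:R / j`!%:R) :> rat.
Proof.
rewrite big_mkord card_derangements; apply: eq_bigr => j _; congr (_ * _).
have jn : (j <= n)%N by rewrite -ltnS.
apply/(canRL (mulfK _)); first by rewrite pnatr_eq0 -lt0n fact_gt0.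
by rewrite -natrM -{2}(subKn jn) ffact_fact // leq_subr.
Qed.

(** * Finite linear combinations as linear maps *)

Section LinearCombination.
Variables (R : comNzRingType) (V : lmodType R) (r : nat) (b : 'I_r -> V).

Definition lincomb (a : 'rV[R]_r) : V := \sum_j a 0 j *: b j.

Fact lincomb_is_linear : linear lincomb.
Proof.
move=> a u v; rewrite /lincomb scaler_sumr -big_split; apply: eq_bigr => j _.
by rewrite !mxE scalerDl scalerA.
Qed.
HB.instance Definition _ :=
  GRing.isLinear.Build R 'rV[R]_r V _ lincomb lincomb_is_linear.
End LinearCombination.

(** * Homology modules *)

Section HomologyCriteria.
Variables (R : comNzRingType) (U V W : lmodType R).
Variables (f : {linear U -> V}) (g : {linear V -> W}).
Local Open Scope quotient_scope.

Notation pi := (\pi_(Quotient.quot (additive_submod (@boundary_pred _ _ _ _ f g)))).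

Lemma pi_eq0 (z : cycles g) : (exists u, f u = val z) -> pi z = 0.
Proof.
move=> fz; have : z - 0 \in additive_submod (boundary_pred f (g := g)).
  by rewrite subr0; apply/asboolP.
by rewrite Quotient.idealrBE => /eqP ->; rewrite raddf0.
Qed.

Lemma homology_eq0 : (forall v, g v = 0 -> exists u, f u = v) ->
  is_zero_module (homology f g).
Proof.
move=> ex x; rewrite -[x]reprK; apply: pi_eq0.
by apply: ex; apply/eqP; exact: (valP (repr x : cycles g)).
Qed.

Lemma pi_inj (z z' : cycles g) : (forall u, f u = 0) -> pi z = pi z' -> z = z'.
Proof.
move=> f0 /eqP; rewrite -Quotient.idealrBE => /asboolP[u].
rewrite f0 => /esym/eqP E; apply/eqP; rewrite -subr_eq0; apply/eqP.
by apply: val_inj; apply/eqP.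
Qed.

(** The quotient is by zero, so a basis of the kernel of [g] is one of the homology. [free_of_rank]
    asks for a bijective linear map, so an inverse obtained by [choice] suffices. *)
Lemma homology_free r (b : 'I_r -> V) : (forall u, f u = 0) ->
  (forall j, g (b j) = 0) -> injective (lincomb b) ->
  (forall v, g v = 0 -> exists a, lincomb b a = v) ->
  free_of_rank (homology f g) r.
Proof.
move=> f0 gb inj surj.
pose bz j : cycles g := Submodule (introT eqP (gb j) : b j \in cycle_pred g).
pose bh j : homology f g := pi (bz j).
have E a : lincomb bh a = pi (lincomb bz a).
  rewrite /lincomb raddf_sum; apply: eq_bigr => j _.
  exact: pi_scale.
have vE a : val (lincomb bz a) = lincomb b a.
  by rewrite /lincomb raddf_sum.
have [|h' h'K] := @choice _ _ (fun y a => lincomb bh a = y).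
  move=> y; have [|a Ea] := surj (val (repr y : cycles g)).
    by apply/eqP; exact: (valP (repr y : cycles g)).
  exists a; rewrite E -[y in RHS]reprK; congr pi.
  by apply: val_inj; rewrite vE.
exists (lincomb bh); exists h' => // a; apply: inj.
by rewrite -!vE; congr val; apply: pi_inj => //; rewrite -!E h'K.
Qed.
End HomologyCriteria.

(** * The path complex of the complete graph as the complex of injective words *)

Section CompleteGraph.
Variables (R : comNzRingType) (n : nat).
Notation e := (@complete_digraph n).

Lemma strongly_regular_complete m (x : m.+1.-tuple 'I_n) :
  strongly_regular_allowed e x = uniq x.
Proof.
rewrite /strongly_regular_allowed uniq_pairwise andb_idl //.
exact: pairwise_sorted.
Qed.

Lemma mem_A m (v : Lambda R 'I_n m) :
  v \in A_pred e (m := m) <-> forall x : m.+1.-tuple 'I_n, ~~ uniq x -> v x = 0.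
Proof.
split=> [/forallP vA x nx|vA].
  by have := vA x; rewrite strongly_regular_complete nx => /eqP.
apply/forallP => x; rewrite strongly_regular_complete; apply/implyP => nx.
by rewrite vA.
Qed.

(** Deleting an entry keeps the entries distinct, and distinct vertices are always joined, so the
    boundary of an allowed chain is allowed. *)
Lemma mem_Omega m (v : Lambda R 'I_n m) :
  v \in Omega_pred e (m := m) <-> forall x : m.+1.-tuple 'I_n, ~~ uniq x -> v x = 0.
Proof.
case: m v => [|m] v; first exact: mem_A.
rewrite -mem_A; split=> [/andP[]//|vA]; apply/andP; split=> //.
apply/mem_A => y ny; rewrite bdE; apply: boundary_uniq => //.
exact/mem_A.
Qed.

Lemma Omega_uniq0 m (v : Omega R e m) (x : m.+1.-tuple 'I_n) :
  ~~ uniq x -> val v x = 0.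
Proof. by move: x; apply/mem_Omega; exact: valP. Qed.

Lemma Omega_of m (v : m.+1.-tuple 'I_n -> R) :
  (forall x : m.+1.-tuple 'I_n, ~~ uniq x -> v x = 0) ->
  exists w : Omega R e m, forall x, val w x = v x.
Proof.
move=> vu; pose v' : Lambda R 'I_n m := [ffun x => v x].
have v'O : v' \in Omega_pred e (m := m) by apply/mem_Omega => x /vu; rewrite ffunE.
by exists (Submodule v'O) => x; rewrite ffunE.
Qed.

Lemma Omega_ext m (v w : Omega R e m) : (forall x, val v x = val w x) -> v = w.
Proof. by move=> vw; apply: val_inj; apply/ffunP. Qed.

Lemma Omega_trivial m (v : Omega R e m) : (n <= m)%N -> v = 0.
Proof.
move=> nm; apply: Omega_ext => x; rewrite ffunE Omega_uniq0 //.
by apply/negP => /uniq_size_le; rewrite size_tuple; lia.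
Qed.

Lemma path_bd_eq0 m (v : Omega R e m.+1) : path_bd v = 0 <-> word_cycle (val v).
Proof.
split=> [E y|vc]; first by rewrite -bdE -[bd _]/(val (path_bd v)) E ffunE.
by apply: Omega_ext => y; rewrite /= bdE vc ffunE.
Qed.

Lemma augmentation_inc (v : Omega R e 0) (y : 0.-tuple 'I_n) :
  augmentation v = \sum_x val v x * inc R x y.
Proof. by apply: eq_bigr => x _; rewrite inc0 mulr1. Qed.

Lemma augmentation_eq0 (v : Omega R e 0) : augmentation v = 0 <-> word_cycle (val v).
Proof.
by split=> [E y|/(_ [tuple])]; rewrite -augmentation_inc.
Qed.

Section Degree.
Variables (m : nat) (W : lmodType R) (g : {linear Omega R e m -> W}).
(** This covers the augmentation ([m = 0]) and [path_bd] at once. *)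
Hypothesis g_cycle : forall v, g v = 0 <-> word_cycle (val v).

Lemma complete_homology0 : m.+1 != n -> is_zero_module (homology (@path_bd R _ e m) g).
Proof.
move=> mn; apply: homology_eq0 => v /g_cycle vc; have [nm|mltn] := leqP n m.
  by exists 0; rewrite linear0 [v]Omega_trivial.
have {}mn : (m.+1 < n)%N by lia.
have [u [uu ud]] := words_exact mn (@Omega_uniq0 _ v) vc.
have [w wu] := Omega_of uu; exists w; apply: Omega_ext => y.
by rewrite /= bdE -ud; apply: eq_bigr => x _; rewrite wu.
Qed.

(** The cycles from [crit_cycle] are dual to the critical words: evaluation there reads off the
    coefficients of a combination and, by [cycle_crit0], determines a cycle. *)
Lemma complete_homology_top : m.+1 = n ->
  free_of_rank (homology (@path_bd R _ e m) g) #|@crit n m.+1|.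
Proof.
move=> mn; have kn : (m < n)%N by rewrite -mn.
pose w (j : 'I_#|@crit n m.+1|) : m.+1.-tuple 'I_n := enum_val j.
have cw j : crit (w j) by have := enum_valP j; rewrite unfold_in.
have bex j : exists b : Omega R e m,
    word_cycle (val b) /\ forall x, crit x -> val b x = (x == w j)%:R.
  have [v [vu vc vw]] := crit_cycle R kn (cw j); have [u uv] := Omega_of vu.
  have E : (val u : _ -> R) = v by apply: functional_extensionality_dep.
  by exists u; rewrite E.
have [b bP] := fin_all_exists bex.
have combE a j : val (lincomb b a) (w j) = a 0 j.
  rewrite /lincomb raddf_sum sum_ffunE (bigD1 j) //= big1 ?addr0 => [|i ij].
    by rewrite ffunE (bP j).2 // eqxx; exact: mulr1.
  rewrite ffunE (bP i).2 // (inj_eq enum_val_inj) eq_sym (negPf ij).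
  exact: mulr0.
apply: (homology_free (b := b)) => [u|j|a a' E|v vc].
- by rewrite [u]Omega_trivial ?linear0 // -mn.
- by apply/g_cycle; case: (bP j).
- by apply/rowP => j; rewrite -!combE E.
exists (\row_j val v (w j)).
apply/eqP; rewrite -subr_eq0; apply/eqP/Omega_ext => x; rewrite [RHS]ffunE.
move: x; apply: cycle_crit0 => [x||x cx]; first exact: Omega_uniq0.
  apply/g_cycle; rewrite linearB vc subr0 /lincomb raddf_sum big1 // => j _.
  apply: etrans (linearZZ g _ _) _.
  by rewrite (g_cycle (b j)).2 ?scaler0 //; case: (bP j).
have -> : x = w (enum_rank_in cx x) by rewrite /w enum_rankK_in.
by rewrite !ffunE combE mxE subrr.
Qed.

End Degree.

(** This is exactness at the empty word, where every chain is a cycle. *)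
Lemma augmentation_onto (r : R^o) : (0 < n)%N -> exists v : Omega R e 0, augmentation v = r.
Proof.
move=> n0; have [||v [vu vr]] := @words_exact R n 0 (fun=> r) n0 => [x|//|].
  by rewrite [x]tuple0.
have [w wv] := Omega_of vu; exists w.
by rewrite (augmentation_inc _ [tuple]) -(vr [tuple]); apply: eq_bigr => x _; rewrite wv.
Qed.

End CompleteGraph.

Theorem corollary5p19 (R : comNzRingType) (n : nat) (hn : (1 <= n)%N) :
  [/\ forall m : int, m != n%:Z - 1 ->
        is_zero_module (reduced_path_homology R (@complete_digraph n) m),
      free_of_rank (reduced_path_homology R (@complete_digraph n) (n%:Z - 1))
        #|derangements n|
    & #|derangements n|%:R
        = \sum_(0 <= j < n.+1) (-1) ^+ j * (n`!%:R / j`!%:R) :> rat].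
Proof.
split; last exact: card_derangements_fact.
- case=> [[|k]|[|k]] mn /=.
  + by apply: complete_homology0; [exact: augmentation_eq0|lia].
  + by apply: complete_homology0; [exact: path_bd_eq0|lia].
  + by apply: homology_eq0 => r _; exact: augmentation_onto.
  + by move=> x; apply/rowP => -[].
(* The top degree is 0 only for [n = 1], where the outgoing map is the augmentation. *)
- rewrite card_derangements_crit; case: n hn => // -[|k] _.
  + by apply: complete_homology_top => //; exact: augmentation_eq0.
  + have -> : k.+2%:Z - 1 = k.+1%:Z by lia.
    by apply: complete_homology_top => //; exact: path_bd_eq0.
Qed.
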